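(* Let $D$ be a vf-safe delta-matroid with ground set $[n]$, let $(U,\Omega)$ be an $(n,3)$-carrier, let $\tau=(T_1,T_2,T_3)$ be a transversal $3$-tuple of $(U,\Omega)$, and let $\sigma:U\to[n]$ be a projection of $(U,\Omega)$. Then $$\operatorname{Orb}(D)=\{D' \mid \exists\,\tau'\in\mathbb{T}_{(U,\Omega)}\text{ and }\sigma'\in\mathbb{P}_{(U,\Omega)}\text{ such that } Z_{D',\tau',\sigma'}=Z_{D,\tau,\sigma}\},$$ where $D'$ ranges over vf-safe delta-matroids with ground set $[n]$.
   Context: Set systems and the group action. A set system on $[n]=\{1,\dots,n\}$ is a pair $D=([n],\mathcal{F})$, $\mathcal{F}=\mathcal{F}(D)$ a collection of subsets of $[n]$ (feasible sets). It is a delta-matroid if $\mathcal{F}\ne\emptyset$ and for all $X,Y\in\mathcal{F}$ and $u\in X\triangle Y$ there is $v\in X\triangle Y$ (possibly $v=u$) with $X\triangle\{u,v\}\in\mathcal{F}$. For $i\in[n]$: $D\ast i=([n],\{X\triangle\{i\}:X\in\mathcal{F}\})$ and $D+i=([n],\mathcal{F}\triangle\{I\cup\{i\}:I\in\mathcal{F},i\notin I\})$. For fixed $i$ these satisfy the relations of $\mathcal{G}=\langle\ast,+\mid\ast^2,+^2,(\ast+)^3\rangle\cong S_3$; write $\overline{\ast}=+\ast+=\ast+\ast$. For a word $g=g_1\cdots g_k$, $D\,g\,i:=(\cdots(D\,g_k\,i)\cdots)g_1\,i$. Operations on distinct elements commute. For $\hat g=(g_1,\dots,g_n)\in\mathcal{G}^n$,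 $\hat g\cdot D$ is obtained by applying $g_i$ to $i$ for all $i$. For $I\subseteq[n]$, $D\overline{\ast}I$ applies $\overline{\ast}$ to every element of $I$; equivalently, $X\in\mathcal{F}(D\overline{\ast}I)$ iff $|\{Y\in\mathcal{F}(D): X\subseteq Y\subseteq X\cup I\}|$ is odd. $D$ is vf-safe if $\hat g\cdot D$ is a delta-matroid for all $\hat g\in\mathcal{G}^n$. For $\pi\in S_n$, $D_\pi=([n],\{\pi(I):I\in\mathcal{F}\})$. The semidirect product $\mathcal{G}^n\rtimes_\phi S_n$, with $(\hat g,\pi_1)(\hat h,\pi_2)=(\hat g\circ\hat h\pi_1^{-1},\pi_1\pi_2)$, $\circ$ componentwise, $(\hat h\pi^{-1})(i)=h_{\pi^{-1}(i)}$, acts on set systems by $(\hat g,\pi)D=\hat g\cdot D_\pi$; $\operatorname{Orb}(D)$ is the orbit of $D$. Carriers and lifts. An $(n,3)$-carrier is a pair $(U,\Omega)$ with $\Omega$ a partition of a finite set $U$ into $n$ classes (skew classes), each of size $3$. A transversal of $\Omega$ is a subset of $U$ meeting each class in exactly one element; $\mathcal{T}(\Omega)$ is the set of transversals. A transversal $3$-tuple is an ordered triple $(T_1,T_2,T_3)$ of mutually disjoint transversals with union $U$; $\mathbb{T}_{(U,\Omega)}$ is the set of them. A projection is a surjection $\sigma:U\to[n]$ with $\sigma(x)=\sigma(y)$ iff $x,y$ lie in the same skew class; $\mathbb{P}_{(U,\Omega)}$ is the set of them. For a vf-safe delta-matroid $D$ on $[n]$, $\tau=(T_1,T_2,T_3)$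 and $\sigma$, let $$\mathcal{B}_{D,\tau,\sigma}=\{B\in\mathcal{T}(\Omega)\mid \sigma(B\cap T_2)\in\mathcal{F}(D\,\overline{\ast}\,\sigma(B\cap T_3))\}$$ and $Z_{D,\tau,\sigma}=(U,\Omega,\mathcal{B}_{D,\tau,\sigma}^* )$, where $\mathcal{B}^*=\{I\mid I\subseteq B\text{ for some }B\in\mathcal{B}\}$. This is a tight $3$-matroid with set of bases $\mathcal{B}_{D,\tau,\sigma}$, called the lift of $D$. *)

(* Defs.v *)
From HB Require Import structures.
From mathcomp Require Import all_boot all_fingroup.

Set Implicit Arguments.
Unset Strict Implicit.
Unset Printing Implicit Defensive.

Definition symdiff (T : finType) (A B : {set T}) : {set T} :=
  (A :\: B) :|: (B :\: A).

(* The ground set [n] is 'I_n; a set system on it is its collection of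
   feasible sets. *)
Definition setsystem (n : nat) := {set {set 'I_n}}.

Definition is_delta_matroid n (D : setsystem n) : bool :=
  (D != set0) &&
  [forall X in D, forall Y in D, forall u in symdiff X Y,
     exists v in symdiff X Y, symdiff X [set u; v] \in D].

Definition twist n (D : setsystem n) (i : 'I_n) : setsystem n :=
  [set symdiff X [set i] | X in D].

Definition loopc n (D : setsystem n) (i : 'I_n) : setsystem n :=
  symdiff D [set i |: I | I : {set 'I_n} in D & i \notin I].

Inductive gen := Star | Plus.

Definition gen_op n (a : gen) (D : setsystem n) (i : 'I_n) : setsystem n :=
  match a with Star => twist D i | Plus => loopc D i end.

(* A word g_1 ... g_k acts with g_k first. *)
Definition word_op n (w : seq gen) (D : setsystem n) (i : 'I_n) : setsystem n :=
  foldr (fun a E => gen_op a E i) D w.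

(* The group < *, + | *^2, +^2, ( *+ )^3 >, each element being named after a
   reduced word: 1, *, +, *+, +*, and +*+ = *+*. *)
Inductive twist_group := G1 | Gs | Gp | Gsp | Gps | Gpsp.

Definition word (g : twist_group) : seq gen :=
  match g with
  | G1 => [::]
  | Gs => [:: Star]
  | Gp => [:: Plus]
  | Gsp => [:: Star; Plus]
  | Gps => [:: Plus; Star]
  | Gpsp => [:: Plus; Star; Plus]
  end.

Definition gen_mul (a : gen) (g : twist_group) : twist_group :=
  match a, g with
  | Star, G1 => Gs | Star, Gs => G1 | Star, Gp => Gsp
  | Star, Gsp => Gp | Star, Gps => Gpsp | Star, Gpsp => Gps
  | Plus, G1 => Gp | Plus, Gp => G1 | Plus, Gs => Gps
  | Plus, Gps => Gs | Plus, Gsp => Gpsp | Plus, Gpsp => Gsp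
  end.

Definition tg_mul (g h : twist_group) : twist_group := foldr gen_mul h (word g).

Definition tg_inv (g : twist_group) : twist_group :=
  match g with Gsp => Gps | Gps => Gsp | _ => g end.

Definition tg_code (g : twist_group) : 'I_6 :=
  match g with
  | G1 => inord 0 | Gs => inord 1 | Gp => inord 2
  | Gsp => inord 3 | Gps => inord 4 | Gpsp => inord 5
  end.
Definition tg_decode (k : 'I_6) : twist_group :=
  nth G1 [:: G1; Gs; Gp; Gsp; Gps; Gpsp] k.
Lemma tg_codeK : cancel tg_code tg_decode.
Proof. by case; rewrite /tg_decode /= inordK. Qed.

HB.instance Definition _ := Finite.copy twist_group (can_type tg_codeK).

Lemma tg_mulA : associative tg_mul. Proof. by do 3!case. Qed.
Lemma tg_mul1g : left_id G1 tg_mul. Proof. by []. Qed.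
Lemma tg_mulVg : left_inverse G1 tg_inv tg_mul. Proof. by case. Qed.

HB.instance Definition _ :=
  Finite_isGroup.Build twist_group tg_mulA tg_mul1g tg_mulVg.

Lemma tg_relations :
  [/\ (Gs ^+ 2 = 1)%g, (Gp ^+ 2 = 1)%g, ((Gs * Gp) ^+ 3 = 1)%g,
      <<[set Gs; Gp]>>%g = [set: twist_group] & #|[set: twist_group]| = 6].
Proof.
split=> //.
  apply/eqP; rewrite eqEsubset subsetT; apply/subsetP=> g _.
  have s_in : Gs \in <<[set Gs; Gp]>>%g by rewrite mem_gen // !inE eqxx.
  have p_in : Gp \in <<[set Gs; Gp]>>%g by rewrite mem_gen // !inE eqxx orbT.
  case: g => //.
  - exact: group1.
  - exact: (groupM s_in p_in).
  - exact: (groupM p_in s_in).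
  - exact: (groupM p_in (groupM s_in p_in)).
rewrite cardsT -(card_ord 6); apply: (bij_eq_card (f := tg_code)).
exists tg_decode; first exact: tg_codeK.
by case; do 6?[case=> [lti|]; first by apply/val_inj; rewrite /= inordK].
Qed.

Definition tg_op n (g : twist_group) (D : setsystem n) (i : 'I_n) :
  setsystem n := word_op (word g) D i.

(* The order in which the elements i are treated is immaterial
   (tg_op_comm below). *)
Definition hat_op n (g : {ffun 'I_n -> twist_group}) (D : setsystem n) :
  setsystem n := foldr (fun i E => tg_op (g i) E i) D (enum 'I_n).

Definition dual_star n (D : setsystem n) (I : {set 'I_n}) : setsystem n :=
  foldr (fun i E => word_op [:: Plus; Star; Plus] E i) D (enum I).

Definition vf_safe n (D : setsystem n) : bool :=
  [forall g : {ffun 'I_n -> twist_group}, is_delta_matroid (hat_op g D)].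

Definition relabel n (p : 'S_n) (D : setsystem n) : setsystem n :=
  [set p @: I | I : {set 'I_n} in D].

(* The semidirect product of twist_group^n and S_n. *)
Definition sdgroup (n : nat) := ({ffun 'I_n -> twist_group} * 'S_n)%type.
HB.instance Definition _ n := Finite.on (sdgroup n).

(* Permutations compose here as functions, p1 after p2, while the product of
   'S_n applies its left factor first. *)
Definition sd_mul n (x y : sdgroup n) : sdgroup n :=
  ([ffun i => (x.1 i * y.1 ((x.2^-1)%g i))%g], (y.2 * x.2)%g).
Definition sd_one n : sdgroup n := ([ffun=> 1%g], 1%g).
Definition sd_inv n (x : sdgroup n) : sdgroup n :=
  ([ffun i => ((x.1 (x.2 i))^-1)%g], (x.2^-1)%g).

Lemma sd_mulA n : associative (@sd_mul n).
Proof.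
move=> x y z; congr pair; last by rewrite /= mulgA.
by apply/ffunP=> i; rewrite !ffunE /= mulgA invMg permM.
Qed.
Lemma sd_mul1g n : left_id (sd_one n) (@sd_mul n).
Proof.
move=> [g p]; congr pair; last by rewrite mulg1.
by apply/ffunP=> i; rewrite !ffunE /= mul1g invg1 perm1.
Qed.
Lemma sd_mulVg n : left_inverse (sd_one n) (@sd_inv n) (@sd_mul n).
Proof.
move=> [g p]; congr pair; last by rewrite /= mulgV.
by apply/ffunP=> i; rewrite !ffunE /= invgK mulVg.
Qed.

HB.instance Definition _ n :=
  Finite_isGroup.Build (sdgroup n) (@sd_mulA n) (@sd_mul1g n) (@sd_mulVg n).

Definition sd_act n (x : sdgroup n) (D : setsystem n) : setsystem n :=
  hat_op x.1 (relabel x.2 D).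

Definition Orb n (D : setsystem n) : {set setsystem n} :=
  [set sd_act x D | x : sdgroup n].

(* (U, Omega) is an (n,3)-carrier, U being the whole finite type. *)
Definition is_carrier3 (n : nat) (U : finType) (Omega : {set {set U}}) : bool :=
  [&& partition Omega [set: U], #|Omega| == n
    & [forall S in Omega, #|S| == 3]].

Definition transversals (U : finType) (Omega : {set {set U}}) : {set {set U}} :=
  [set T | is_transversal T Omega [set: U]].

Definition transversal_triples (U : finType) (Omega : {set {set U}}) :
    {set {set U} * {set U} * {set U}} :=
  [set tau | let: (T1, T2, T3) := tau in
    [&& T1 \in transversals Omega, T2 \in transversals Omega,
        T3 \in transversals Omega,
        [disjoint T1 & T2], [disjoint T1 & T3], [disjoint T2 & T3]
      & T1 :|: T2 :|: T3 == [set: U]]].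

Definition projections (n : nat) (U : finType) (Omega : {set {set U}}) :
    {set {ffun U -> 'I_n}} :=
  [set sigma : {ffun U -> 'I_n} | [forall i, exists x, sigma x == i] &&
    [forall x, forall y,
       (sigma x == sigma y) == (pblock Omega x == pblock Omega y)]].

Definition lift_bases n (U : finType) (Omega : {set {set U}}) (D : setsystem n)
    (tau : {set U} * {set U} * {set U}) (sigma : {ffun U -> 'I_n}) :
    {set {set U}} :=
  let: (T1, T2, T3) := tau in
  [set B in transversals Omega |
     sigma @: (B :&: T2) \in dual_star D (sigma @: (B :&: T3))].

Definition down_closure (U : finType) (Bs : {set {set U}}) : {set {set U}} :=
  [set I : {set U} | [exists B in Bs, I \subset B]].

Definition tight_lift n (U : finType) (Omega : {set {set U}}) (D : setsystem n)
    (tau : {set U} * {set U} * {set U}) (sigma : {ffun U -> 'I_n}) :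
    {set U} * {set {set U}} * {set {set U}} :=
  ([set: U], Omega, down_closure (lift_bases Omega D tau sigma)).

Section Facts.
Variable n : nat.
Implicit Types (D : setsystem n) (X : {set 'I_n}) (i j : 'I_n) (w : seq gen).

Lemma in_symdiff (T : finType) (A B : {set T}) x :
  (x \in symdiff A B) = (x \in A) (+) (x \in B).
Proof. by rewrite !inE; case: (x \in A); case: (x \in B). Qed.

Lemma in_twist D i X : (X \in twist D i) = (symdiff X [set i] \in D).
Proof.
have symK (Y : {set 'I_n}) : symdiff (symdiff Y [set i]) [set i] = Y.
  by apply/setP=> x; rewrite !in_symdiff -addbA addbb addbF.
apply/imsetP/idP=> [[Y YD ->]|XD]; first by rewrite symK.
by exists (symdiff X [set i]); rewrite ?symK.
Qed.

Lemma in_loopc D i X :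
  (X \in loopc D i) = (X \in D) (+) ((i \in X) && (X :\ i \in D)).
Proof.
rewrite in_symdiff; congr (_ (+) _); apply/imsetP/andP=> [[I]|[iX XD]].
  by rewrite inE => /andP[ID iI] ->; rewrite setU11 setU1K.
by exists (X :\ i); rewrite ?setD1K // inE XD setD11.
Qed.

Lemma symdiff1 X i : symdiff X [set i] = if i \in X then X :\ i else i |: X.
Proof.
apply/setP=> x; rewrite in_symdiff; case: ifP=> iX; rewrite !inE;
by case: eqP=> [->|]; rewrite ?iX /= ?addbF.
Qed.

Lemma twistK D i : twist (twist D i) i = D.
Proof.
apply/setP=> X; rewrite !in_twist; congr (_ \in D).
by apply/setP=> x; rewrite !in_symdiff -addbA addbb addbF.
Qed.

Lemma loopcK D i : loopc (loopc D i) i = D.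
Proof.
apply/setP=> X; rewrite !in_loopc setD11 /= addbF.
by case: (i \in X); rewrite /= ?addbF // -addbA addbb addbF.
Qed.

Lemma braid D i :
  loopc (twist (loopc D i) i) i = twist (loopc (twist D i) i) i.
Proof.
apply/setP=> X; rewrite !(in_loopc, in_twist) !symdiff1.
case: (boolP (i \in X)) => iX;
  rewrite ?setD11 ?setU11 /= ?(setD1K iX) ?(setU1K iX) ?setU11 ?setD11
    ?(negPf iX) ?iX /= ?(setD1K iX) ?(setU1K iX) ?addbF //.
  by do 2!case: (_ \in D).
by do 2!case: (_ \in D).
Qed.

Lemma gen_op_mul a g D i :
  word_op (word (gen_mul a g)) D i = gen_op a (word_op (word g) D i) i.
Proof. by case: a g => -[]; rewrite /= ?twistK ?loopcK ?braid ?twistK ?loopcK. Qed.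

Lemma tg_opM g h D i : tg_op (g * h)%g D i = tg_op g (tg_op h D i) i.
Proof.
rewrite /tg_op -[(g * h)%g]/(foldr gen_mul h (word g)).
by elim: (word g) => //= a w IHw; rewrite gen_op_mul IHw.
Qed.

(* Any word may be used to compute the action of the element it represents. *)
Definition gen_elt (a : gen) : twist_group := match a with Star => Gs | Plus => Gp end.

Lemma word_opE w D i : word_op w D i = tg_op (\prod_(a <- w) gen_elt a)%g D i.
Proof.
elim: w => [|a w IHw]; rewrite ?big_nil // big_cons tg_opM -IHw.
by case: a.
Qed.

Lemma gen_op_comm a b D i j :
  i != j -> gen_op a (gen_op b D i) j = gen_op b (gen_op a D j) i.
Proof.
move=> nij; have nji : j != i by rewrite eq_sym.
have sdC (X : {set 'I_n}) :
    symdiff (symdiff X [set i]) [set j] = symdiff (symdiff X [set j]) [set i].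
  by apply/setP=> x; rewrite !in_symdiff addbAC.
have sdD (X : {set 'I_n}) k l : k != l ->
    symdiff (X :\ k) [set l] = symdiff X [set l] :\ k.
  move=> nkl; apply/setP=> x; rewrite in_setD1 !in_symdiff !inE.
  by case: eqP => [->|]; rewrite ?(negPf nkl).
have D1C (X : {set 'I_n}) : X :\ i :\ j = X :\ j :\ i.
  by apply/setP=> x; rewrite !inE andbCA.
have sdi (X : {set 'I_n}) k l : k != l -> (k \in symdiff X [set l]) = (k \in X).
  by move=> nkl; rewrite in_symdiff inE (negPf nkl) addbF.
apply/setP=> X; case: a; case: b;
  rewrite /= ?in_twist ?in_loopc ?in_twist ?in_loopc ?sdC ?sdi ?sdD //.
rewrite !in_setD1 nij nji /= D1C.
case: (i \in X); case: (j \in X); rewrite /= ?addbF ?addFb //.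
by rewrite -!addbA; congr (_ (+) _); rewrite addbCA.
Qed.

Lemma word_op_comm w v D i j :
  i != j -> word_op w (word_op v D i) j = word_op v (word_op w D j) i.
Proof.
move=> nij.
have step a u E : gen_op a (word_op u E i) j = word_op u (gen_op a E j) i.
  by elim: u => //= b u IHu; rewrite gen_op_comm // IHu.
by elim: w => //= a w ->; rewrite step.
Qed.

Lemma tg_op_comm g h D i j :
  i != j -> tg_op g (tg_op h D i) j = tg_op h (tg_op g D j) i.
Proof. exact: word_op_comm. Qed.

Definition seq_op (g : 'I_n -> twist_group) D (s : seq 'I_n) :=
  foldr (fun i E => tg_op (g i) E i) D s.

Lemma seq_op_out g h D s i : i \notin s ->
  seq_op g (tg_op h D i) s = tg_op h (seq_op g D s) i.
Proof.
elim: s => //= j s IHs; rewrite inE negb_or => /andP[nij /IHs ->].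
by rewrite tg_op_comm.
Qed.

Lemma seq_opM (g h : 'I_n -> twist_group) D s : uniq s ->
  seq_op (fun i => g i * h i)%g D s = seq_op g (seq_op h D s) s.
Proof.
elim: s => //= i s IHs /andP[Ns /IHs ->].
by rewrite tg_opM seq_op_out.
Qed.

Lemma seq_op_perm g D s t : uniq s -> perm_eq s t -> seq_op g D s = seq_op g D t.
Proof.
elim: s t => [|i s IHs] t; first by rewrite perm_sym => _ /perm_nilP ->.
move=> /= /andP[Ns Us] st.
have it : i \in t by rewrite -(perm_mem st) mem_head.
case/splitPr: it st => t1 t2.
rewrite perm_sym -cat1s perm_catCA perm_cons perm_sym => st.
have catE u v : seq_op g D (u ++ v) = seq_op g (seq_op g D v) u.
  exact: foldr_cat.
rewrite (IHs _ Us st) !catE /= seq_op_out //.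
by apply: contra Ns; rewrite (perm_mem st) mem_cat => ->.
Qed.

Lemma hat_opM (g h : {ffun 'I_n -> twist_group}) D :
  hat_op [ffun i => g i * h i]%g D = hat_op g (hat_op h D).
Proof.
have -> : hat_op g (hat_op h D) = seq_op g (seq_op h D (enum 'I_n)) (enum 'I_n).
  by [].
rewrite -seq_opM ?enum_uniq // /hat_op.
by elim: (enum _) => //= i s ->; rewrite ffunE.
Qed.

Lemma imset_permK (p : 'S_n) (X : {set 'I_n}) : p @: ((p^-1)%g @: X) = X.
Proof. by rewrite -imset_comp -[RHS]imset_id; apply: eq_imset => x /=; rewrite permKV. Qed.

Lemma in_relabel (p : 'S_n) D X : (X \in relabel p D) = ((p^-1)%g @: X \in D).
Proof.
apply/imsetP/idP=> [[I ID ->]|XD].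
  by have := imset_permK (p^-1)%g I; rewrite invgK => ->.
by exists ((p^-1)%g @: X); rewrite ?imset_permK.
Qed.

Lemma relabelM (p q : 'S_n) D : relabel (q * p)%g D = relabel p (relabel q D).
Proof.
apply/setP=> X; rewrite !in_relabel -imset_comp invMg; congr (_ \in D).
by apply: eq_imset => x; rewrite /= permM.
Qed.

Lemma relabel1 D : relabel 1 D = D.
Proof.
apply/setP=> X; rewrite in_relabel invg1 -[in RHS](imset_id X).
by congr (_ \in D); apply: eq_imset => x; rewrite perm1.
Qed.

Lemma relabel_gen_op (p : 'S_n) a D i :
  relabel p (gen_op a D i) = gen_op a (relabel p D) (p i).
Proof.
have mem (X : {set 'I_n}) : (i \in (p^-1)%g @: X) = (p i \in X).
  by rewrite -{1}[i](permK p) mem_imset //; apply: perm_inj.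
apply/setP=> X; case: a; rewrite /= in_relabel ?in_twist ?in_loopc !in_relabel.
  congr (_ \in D); apply/setP=> x; rewrite in_symdiff.
  rewrite -[x](permK p) !mem_imset; try exact: perm_inj.
  by rewrite in_symdiff permK !inE (inj_eq perm_inj).
rewrite mem; congr (_ (+) (_ && (_ \in D))); apply/setP=> x.
rewrite in_setD1 -[x](permK p) !mem_imset; try exact: perm_inj.
by rewrite in_setD1 permK (inj_eq perm_inj).
Qed.

Lemma relabel_tg_op (p : 'S_n) g D i :
  relabel p (tg_op g D i) = tg_op g (relabel p D) (p i).
Proof. by rewrite /tg_op; elim: (word g) => //= a w IHw; rewrite relabel_gen_op IHw. Qed.

Lemma relabel_hat_op (p : 'S_n) (g : {ffun 'I_n -> twist_group}) D :
  relabel p (hat_op g D) = hat_op [ffun i => g ((p^-1)%g i)] (relabel p D).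
Proof.
set gp := [ffun i => _].
have -> : hat_op gp (relabel p D) = seq_op gp (relabel p D) (map p (enum 'I_n)).
  apply: seq_op_perm; first exact: enum_uniq.
  apply: uniq_perm; rewrite ?enum_uniq ?(map_inj_uniq (@perm_inj _ p)) ?enum_uniq //.
  by move=> x; rewrite -[x](permKV p) (mem_map (@perm_inj _ p)) !mem_enum.
rewrite /hat_op; elim: (enum _) => //= i s IHs.
by rewrite relabel_tg_op IHs ffunE permK.
Qed.

Lemma sd_act1 D : sd_act 1%g D = D.
Proof.
rewrite /sd_act relabel1 /hat_op; elim: (enum _) => //= i s ->.
by rewrite ffunE.
Qed.

Lemma sd_actM (x y : sdgroup n) D : sd_act (x * y)%g D = sd_act x (sd_act y D).
Proof.
rewrite /sd_act relabelM relabel_hat_op -hat_opM; congr hat_op.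
by apply/ffunP=> i; rewrite !ffunE.
Qed.
End Facts.

(* Main.v *)
Require Import Defs.
From mathcomp Require Import all_boot all_fingroup.

(** The whole proof runs on the Boolean function [k |-> (set0 \in hat_op k D)]
of [k] in [twist_group ^ n].  Since [+] preserves feasibility of the empty set,
this function only depends on the right cosets of [{1, +}] containing the
components of [k]; these three cosets, represented by 1, [*] and [+*+],
correspond to the three elements of a skew class, and the group acts on them as
the full symmetric group S_3.  A basis of the lift is a choice of one coset per
skew class, and it is tested by exactly this function.  Hence acting on [D] by
[(g, p)] amounts to relabelling the transversal triple by [g] and the projection
by [p], and every triple and projection is reached in this way. *)

Set Implicit Arguments.
Unset Strict Implicit.
Unset Printing Implicit Defensive.

(* The representative in {1, *, +*+} of the right coset of {1, +}. *)
Definition coset_rep (g : twist_group) : twist_group :=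
  match g with
  | G1 | Gp => G1 | Gs | Gps => Gs | Gpsp | Gsp => Gpsp
  end.

Lemma coset_rep_id g : coset_rep (coset_rep g) = coset_rep g.
Proof. by case: g. Qed.

(** Right multiplication permutes the three cosets, and [g^-1] induces the inverse of the
    permutation induced by [g]. *)
Lemma coset_rep_mulV g a b : coset_rep a = a -> coset_rep b = b ->
  (coset_rep (a * g^-1)%g = b) <-> (coset_rep (b * g)%g = a).
Proof. by case: a => // _; case: b => // _; case: g. Qed.

(** All six permutations of the three cosets come from right multiplications, one for each element
    of the group. *)
Lemma coset_rep_interpolate a b c :
    coset_rep a = a -> coset_rep b = b -> coset_rep c = c ->
    a <> b -> a <> c -> b <> c ->
  exists g, [/\ coset_rep (G1 * g)%g = a, coset_rep (Gs * g)%g = b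
    & coset_rep (Gpsp * g)%g = c].
Proof.
by case: a => // _; case: b => // _; case: c => // _ ab ac bc;
  first [ by case: ab | by case: ac | by case: bc
        | by exists G1 | by exists Gs | by exists Gp | by exists Gsp
        | by exists Gps | by exists Gpsp ].
Qed.

(** * Feasibility of the empty set under the group action *)

Section EmptyFeasible.
Variable n : nat.
Implicit Types (D : setsystem n) (k : {ffun 'I_n -> twist_group}).
Implicit Types (X I : {set 'I_n}).

Definition empty_feasible D k : bool := set0 \in hat_op k D.

(** Loop complementation at [i] changes the status only of sets containing [i], never that of
    [set0]. *)
Lemma hat_op_stab D k : (forall i, coset_rep (k i) = G1) ->
  empty_feasible D k = (set0 \in D).
Proof.
move=> k1; rewrite /empty_feasible /hat_op; elim: (enum _) => //= i s <-.
by have := k1 i; case: (k i) => // _; rewrite /tg_op /= in_loopc inE addbF.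
Qed.

(** Write [k] as [k k'^-1] applied after [k']; the first factor has all its components in {1, +} and
    so leaves the status of [set0] alone. *)
Lemma empty_feasible_rep D k k' :
  (forall i, coset_rep (k i) = coset_rep (k' i)) ->
  empty_feasible D k = empty_feasible D k'.
Proof.
move=> kk'; have -> : k = [ffun i => [ffun j => k j * (k' j)^-1]%g i * k' i]%g.
  by apply/ffunP=> i; rewrite !ffunE mulgKV.
rewrite /empty_feasible hat_opM; apply: hat_op_stab => i; rewrite ffunE.
by have := kk' i; case: (k i); case: (k' i).
Qed.

(** Relabelling fixes [set0], so the permutation can be moved outermost and dropped, at the cost of
    reindexing the components. *)
Lemma empty_feasible_sd_act (x : sdgroup n) D k :
  empty_feasible (sd_act x D) k =
  empty_feasible D [ffun i => k (x.2 i) * x.1 (x.2 i)]%g.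
Proof.
rewrite /empty_feasible /sd_act -hat_opM.
rewrite -[in RHS](imset0 (x.2^-1)%g) -in_relabel relabel_hat_op.
by congr (_ \in hat_op _ _); apply/ffunP=> i; rewrite !ffunE permKV.
Qed.

(** Twisting at every element of [X] carries [X] to the empty set. *)
Lemma mem_empty_feasible D X :
  (X \in D) = empty_feasible D [ffun i => if i \in X then Gs else G1].
Proof.
rewrite /empty_feasible /hat_op; set k := [ffun i => _].
have mem_seq s Y : uniq s ->
    (Y \in foldr (fun i E => tg_op (k i) E i) D s) =
    (symdiff Y [set i in s | i \in X] \in D).
  elim: s Y => [|i s IHs] Y /=.
    move=> _; congr (_ \in D); apply/setP=> x.
    by rewrite in_symdiff !inE addbF.
  case/andP=> Ns /IHs {}IHs; rewrite ffunE.
  case: ifP => iX; rewrite /tg_op /= ?in_twist IHs; congr (_ \in D);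
    apply/setP=> x; rewrite !in_symdiff !inE -?addbA; congr addb;
    by case: (x =P i) => [->|] //=; rewrite ?iX ?(negPf Ns).
rewrite mem_seq ?enum_uniq //; congr (_ \in D).
by apply/setP=> x; rewrite in_symdiff !inE mem_enum.
Qed.

Lemma dual_star_hat_op D I :
  dual_star D I = hat_op [ffun i => if i \in I then Gpsp else G1] D.
Proof.
rewrite /dual_star /hat_op enumT /enum_mem; elim: (Finite.enum _) => //= i s IHs.
by rewrite ffunE; case: ifP => /= _; rewrite IHs.
Qed.

Lemma mem_dual_star D X I : [disjoint X & I] ->
  (X \in dual_star D I) =
  empty_feasible D
    [ffun i => if i \in X then Gs else if i \in I then Gpsp else G1].
Proof.
move=> dXI; rewrite mem_empty_feasible dual_star_hat_op /empty_feasible.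
rewrite -hat_opM; congr (_ \in hat_op _ _); apply/ffunP=> i; rewrite !ffunE.
(* Disjointness rules out a coordinate where the twist and the dual star would multiply. *)
by case: ifP => [/(disjointFr dXI) ->|_] //; case: ifP.
Qed.

Lemma empty_feasible_inj D D' :
  (forall k, (forall i, coset_rep (k i) = k i) ->
     empty_feasible D k = empty_feasible D' k) -> D = D'.
Proof.
move=> DD'; apply/setP=> X; rewrite !mem_empty_feasible DD' // => i.
by rewrite ffunE; case: ifP.
Qed.

End EmptyFeasible.

(** * Vf-safety is constant on orbits *)

Lemma relabel_delta_matroid n (p : 'S_n) (D : setsystem n) :
  is_delta_matroid D -> is_delta_matroid (relabel p D).
Proof.
case/andP=> /set0Pn[Z ZD] /forall_inP DD.
have sdp (q : 'S_n) (A B : {set 'I_n}) :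
    symdiff (q @: A) (q @: B) = q @: symdiff A B.
  apply/setP=> x; rewrite in_symdiff -[x](permKV q).
  by rewrite !mem_imset ?in_symdiff //; apply: perm_inj.
apply/andP; split; first by apply/set0Pn; exists (p @: Z); apply: imset_f.
apply/forall_inP=> _ /imsetP[X XD ->]; apply/forall_inP=> _ /imsetP[Y YD ->].
apply/forall_inP=> u; rewrite sdp => /imsetP[v vXY ->{u}].
have /exists_inP[w wXY wD] :=
  forall_inP (forall_inP (DD _ XD) _ YD) _ vXY.
apply/exists_inP; exists (p w); first exact: imset_f.
have -> : [set p v; p w] = p @: [set v; w] by rewrite imsetU1 imset_set1.
by rewrite sdp; apply: imset_f.
Qed.

Lemma sd_act_vf_safe n (x : sdgroup n) (D : setsystem n) :
  vf_safe D -> vf_safe (sd_act x D).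
Proof.
move=> /forallP D_vf; apply/forallP=> h; rewrite /sd_act -hat_opM.
set k := [ffun i => _].
(* Reindexed in this way, the operations come before the relabelling, and vf-safety of [D] applies
   to them. *)
have -> : k = [ffun i => [ffun j => k (x.2 j)] ((x.2^-1)%g i)].
  by apply/ffunP=> i; rewrite [RHS]ffunE ffunE permKV.
by rewrite -relabel_hat_op; apply: relabel_delta_matroid.
Qed.

(** The three labels are the coset representatives. The last branch is a default; for a transversal
    triple it singles out the third component. *)
Definition label (U : finType) (tau : {set U} * {set U} * {set U}) (x : U) :
    twist_group :=
  if x \in tau.1.1 then G1 else if x \in tau.1.2 then Gs else Gpsp.

Definition triple_of (U : finType) (c : U -> twist_group) :
    {set U} * {set U} * {set U} :=
  ([set x | c x == G1], [set x | c x == Gs], [set x | c x == Gpsp]).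

Lemma label_triple_of (U : finType) (c : U -> twist_group) :
  (forall x, coset_rep (c x) = c x) -> label (triple_of c) =1 c.
Proof.
move=> cE x; rewrite /label /= !inE; have := cE x.
by case: (c x) => //= _; do ?case: eqP.
Qed.

Lemma label_rep (U : finType) (tau : {set U} * {set U} * {set U}) x :
  coset_rep (label tau x) = label tau x.
Proof. by rewrite /label; case: (x \in tau.1.1); case: (x \in tau.1.2). Qed.

(** * Transversals, triples and lifts on a fixed carrier *)

Section Carrier.
Variables (n : nat) (U : finType) (Omega : {set {set U}}).
Hypothesis partO : partition Omega [set: U].
Implicit Types (tau : {set U} * {set U} * {set U}) (sigma : {ffun U -> 'I_n}).
Implicit Types (B : {set U}) (D : setsystem n).

(** The skew classes are the fibres of [sigma], so being a transversal means that [sigma] restricts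
    to a bijection from [B] onto the index set. *)
Lemma transversalP sigma B : sigma \in projections n Omega ->
  reflect ({in B &, injective sigma} /\
           forall i, exists2 x, x \in B & sigma x = i)
          (B \in transversals Omega).
Proof.
rewrite !inE => /andP[/forallP surj /forallP blk].
have{} surj i : exists x, sigma x = i by have /existsP[x /eqP] := surj i; exists x.
have{} blk x y : (sigma x == sigma y) = (pblock Omega x == pblock Omega y).
  by have /forallP/(_ y)/eqP := blk x.
have covT x : x \in cover Omega by rewrite (cover_partition partO) inE.
have tI : trivIset Omega by case/and3P: partO.
have inblk x y : (y \in pblock Omega x) = (sigma y == sigma x).
  by rewrite blk eq_sym eq_pblock.
rewrite /is_transversal partO subsetT /=; apply: (iffP forall_inP).
  move=> BO; have {}BO x : exists z, B :&: pblock Omega x = [set z].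
    by apply/cards1P/BO; rewrite pblock_mem.
  split=> [x y xB yB sxy|i].
    have [z Bz] := BO y.
    have: x \in B :&: pblock Omega y by rewrite inE xB inblk sxy eqxx.
    have: y \in B :&: pblock Omega y by rewrite inE yB inblk eqxx.
    by rewrite Bz => /set1P-> /set1P->.
  have [x <-] := surj i; have [z Bz] := BO x.
  have: z \in B :&: pblock Omega x by rewrite Bz set11.
  by rewrite inE inblk => /andP[zB /eqP]; exists z.
move=> [inj sur] S SO.
have [x xS] : exists x, x \in S.
  by apply/set0Pn; apply: contraTneq SO => ->; case/and3P: partO.
have [y yB syx] := sur (sigma x).
rewrite -(def_pblock tI SO xS); apply/cards1P; exists y; apply/setP=> z.
rewrite !inE inblk -syx; apply/andP/eqP=> [[zB /eqP]|->]; last by [].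
exact: inj.
Qed.

Section Labels.
Variables (tau : {set U} * {set U} * {set U}) (sigma : {ffun U -> 'I_n}).
Hypotheses (sigmaP : sigma \in projections n Omega)
  (tauP : tau \in transversal_triples Omega).

Lemma mem_triple x :
  [/\ (x \in tau.1.1) = (label tau x == G1),
      (x \in tau.1.2) = (label tau x == Gs)
    & (x \in tau.2) = (label tau x == Gpsp)].
Proof.
move: tauP; case: tau => [[T1 T2] T3]; rewrite inE.
case/and5P=> _ _ _ d12 /and3P[d13 d23 /eqP T123].
have := in_setT x; rewrite -T123 !inE /label /=.
case: (boolP (x \in T1)) => [x1|_].
  by rewrite (disjointFr d12 x1) (disjointFr d13 x1) => _; split; apply/esym/eqP.
case: (boolP (x \in T2)) => [x2|_ /= ->]; last by split; apply/esym/eqP.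
by rewrite (disjointFr d23 x2) => _; split; apply/esym/eqP.
Qed.

Lemma triple_labelled a : coset_rep a = a ->
  [set x | label tau x == a] \in transversals Omega.
Proof.
have [E1 E2 E3]: [/\ [set x | label tau x == G1] = tau.1.1,
    [set x | label tau x == Gs] = tau.1.2
  & [set x | label tau x == Gpsp] = tau.2].
  by split; apply/setP=> x; have [m1 m2 m3] := mem_triple x; rewrite inE.
have : [/\ tau.1.1 \in transversals Omega, tau.1.2 \in transversals Omega
    & tau.2 \in transversals Omega].
  by move: tauP; case: tau => [[T1 T2] T3]; rewrite inE => /and5P[].
by case=> t1 t2 t3; case: a => // _; rewrite ?E1 ?E2 ?E3.
Qed.

(** Each label class is a transversal. Together with [label_inj], this makes the pair of [sigma] and
    [label tau] a coordinate system on [U]. *)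
Lemma exists_label i a : coset_rep a = a ->
  exists2 x, sigma x = i & label tau x = a.
Proof.
move=> /triple_labelled/(transversalP _ sigmaP)[_ /(_ i)[x]].
by rewrite inE => /eqP; exists x.
Qed.

Lemma label_inj x y : sigma x = sigma y -> label tau x = label tau y -> x = y.
Proof.
move=> sxy lxy; have /triple_labelled := label_rep tau y.
by case/(transversalP _ sigmaP)=> inj _; apply: inj; rewrite ?inE ?lxy.
Qed.

Lemma transversal_of_labels (k : 'I_n -> twist_group) :
  (forall i, coset_rep (k i) = k i) ->
  [set x | label tau x == k (sigma x)] \in transversals Omega.
Proof.
move=> kE; apply/(transversalP _ sigmaP); split=> [x y|i].
  rewrite !inE => /eqP lx /eqP ly sxy; apply: label_inj => //.
  by rewrite lx ly sxy.
have [x <- lx] := exists_label i (kE i).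
by exists x; rewrite // inE lx.
Qed.

(** Here [k] is the function whose graph, in these coordinates, is [B]. It is [Gs] on the image of
    the second part of [B], [Gpsp] on that of the third and 1 elsewhere, which is the pattern of
    [mem_dual_star]. *)
Lemma mem_lift_bases D B (k : {ffun 'I_n -> twist_group}) :
    B \in transversals Omega -> {in B, forall x, k (sigma x) = label tau x} ->
  (B \in lift_bases Omega D tau sigma) = empty_feasible D k.
Proof.
move=> Bt kB; have [inj sur] := transversalP _ sigmaP Bt.
have memB x T : x \in B -> (sigma x \in sigma @: (B :&: T)) = (x \in T).
  move=> xB; apply/imsetP/idP=> [[y] | xT].
    by rewrite inE => /andP[yB yT] /(inj _ _ xB yB) ->.
  by exists x; rewrite // inE xB.
have -> : (B \in lift_bases Omega D tau sigma) =
    (sigma @: (B :&: tau.1.2) \in dual_star D (sigma @: (B :&: tau.2))).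
  by case: (tau) => [[T1 T2] T3]; rewrite [LHS]inE Bt.
rewrite mem_dual_star.
  congr empty_feasible; apply/ffunP=> i; rewrite ffunE.
  have [x xB <-] := sur i; have [_ m2 m3] := mem_triple x.
  rewrite !memB // kB // m2 m3; have := label_rep tau x.
  by case: (label tau x) => // _; do ?case: eqP.
(* The two images are disjoint because [sigma] is injective on [B] and a point carries a single
   label. *)
rewrite disjoints_subset; apply/subsetP=> i; have [x xB <-] := sur i.
have [_ m2 m3] := mem_triple x.
by rewrite inE !memB // m2 m3 => /eqP ->; apply/eqP.
Qed.

End Labels.

Lemma lift_bases_inj tau sigma D D' : sigma \in projections n Omega ->
    tau \in transversal_triples Omega ->
    lift_bases Omega D tau sigma = lift_bases Omega D' tau sigma ->
  D = D'.
Proof.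
move=> sP tP DD'; apply: empty_feasible_inj => k kE.
(* Every [k] with values among the representatives is tested by some transversal, so the bases
   determine the whole function. *)
have Bt := transversal_of_labels sP tP kE.
rewrite -!(mem_lift_bases sP tP _ Bt) ?DD' // => x;
  by rewrite inE => /eqP.
Qed.

(** The hypotheses say that the group element turns the new coordinates into the old ones. Both
    sides then test [B] by functions that agree coset by coset. *)
Lemma lift_bases_sd_act tau tau' sigma sigma' (x : sdgroup n) D :
    sigma \in projections n Omega -> sigma' \in projections n Omega ->
    tau \in transversal_triples Omega -> tau' \in transversal_triples Omega ->
    (forall u, sigma' u = x.2 (sigma u)) ->
    (forall u, coset_rep (label tau' u * x.1 (sigma' u))%g = label tau u) ->
  lift_bases Omega (sd_act x D) tau' sigma' = lift_bases Omega D tau sigma.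
Proof.
move=> sP sP' tP tP' ss' ll'; apply/setP=> B.
case: (boolP (B \in transversals Omega)) => [Bt | NBt]; last first.
  by rewrite /lift_bases; case: tau tau' {tP tP' ll'} => [[? ?] ?] [[? ?] ?];
    rewrite !inE; move: NBt; rewrite inE => /negPf ->.
have [_ sur] := transversalP _ sP Bt.
pose k (t : {set U} * {set U} * {set U}) (s : {ffun U -> 'I_n}) :=
  (* The default [G1] never matters for a projection [s], since the transversal [B] meets each of
     its fibres. *)
  [ffun i => if [pick u in B | s u == i] is Some u then label t u else G1].
have kB t s : s \in projections n Omega ->
    {in B, forall u, k t s (s u) = label t u}.
  move=> /transversalP/(_ Bt)[inj _] u uB; rewrite ffunE.
  case: pickP => [v /andP[vB /eqP svu]|/(_ u)]; last by rewrite uB eqxx.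
  by rewrite (inj _ _ vB uB svu).
rewrite (mem_lift_bases sP' tP' _ Bt (kB _ _ sP')).
rewrite (mem_lift_bases sP tP _ Bt (kB _ _ sP)) empty_feasible_sd_act.
apply: empty_feasible_rep => i; have [u uB <-] := sur i.
by rewrite ffunE -ss' !kB // ll' label_rep.
Qed.

(** Transversals form an antichain, so a basis of one lift contained in a basis of the other is
    equal to it. *)
Lemma down_closure_bases_inj tau tau' sigma sigma' D D' :
    sigma \in projections n Omega ->
    down_closure (lift_bases Omega D tau sigma) =
      down_closure (lift_bases Omega D' tau' sigma') ->
  lift_bases Omega D tau sigma = lift_bases Omega D' tau' sigma'.
Proof.
move=> sP; have basis_tr t (s : {ffun U -> 'I_n}) E B : B \in lift_bases Omega E t s ->
    B \in transversals Omega.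
  by case: t => [[? ?] ?]; rewrite /lift_bases inE => /andP[].
have antichain B C : B \in transversals Omega -> C \in transversals Omega ->
    B \subset C -> B = C.
  move=> /(transversalP _ sP)[_ sB] /(transversalP _ sP)[iC _] sBC.
  apply/eqP; rewrite eqEsubset sBC; apply/subsetP=> x xC.
  have [y yB syx] := sB (sigma x).
  by rewrite -(iC _ _ (subsetP sBC _ yB) xC syx).
suff half t t' (s s' : {ffun U -> 'I_n}) E E' : down_closure (lift_bases Omega E t s) =
    down_closure (lift_bases Omega E' t' s') ->
    lift_bases Omega E t s \subset lift_bases Omega E' t' s'.
  by move=> eqc; apply/eqP; rewrite eqEsubset !half.
move=> eqc; apply/subsetP=> B Bb.
have: B \in down_closure (lift_bases Omega E t s).
  by rewrite inE; apply/exists_inP; exists B.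
rewrite eqc inE => /exists_inP[C Cb /antichain -> //].
  exact: basis_tr Bb.
exact: basis_tr Cb.
Qed.

(** * Matching changes of triple and projection with group elements *)

Lemma projection_perm sigma sigma' :
    sigma \in projections n Omega -> sigma' \in projections n Omega ->
  exists p : 'S_n, forall u, sigma' u = p (sigma u).
Proof.
rewrite !inE => /andP[/forallP sur /forallP blk] /andP[_ /forallP blk'].
have{} blk x y : (sigma x == sigma y) = (pblock Omega x == pblock Omega y).
  by have /forallP/(_ y)/eqP := blk x.
have{} blk' x y : (sigma' x == sigma' y) = (pblock Omega x == pblock Omega y).
  by have /forallP/(_ y)/eqP := blk' x.
(* A section of [sigma]; the permutation is [sigma'] after [r], well behaved because both
   projections have the same fibres. *)
pose r i := xchoose (existsP (sur i)).
have rK i : sigma (r i) = i by apply/eqP/(xchooseP (existsP (sur i))).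
have inj : injective (fun i => sigma' (r i)).
  by move=> i j /eqP; rewrite blk' -blk !rK => /eqP.
exists (perm inj) => u; rewrite permE.
by apply/eqP; rewrite blk' -blk rK.
Qed.

Lemma perm_projection sigma (p : 'S_n) : sigma \in projections n Omega ->
  [ffun u => p (sigma u)] \in projections n Omega.
Proof.
rewrite !inE => /andP[/forallP sur /forallP blk]; apply/andP; split.
  apply/forallP=> i; have /existsP[x /eqP sx] := sur ((p^-1)%g i).
  by apply/existsP; exists x; rewrite ffunE sx permKV.
apply/forallP=> x; apply/forallP=> y; rewrite !ffunE (inj_eq perm_inj).
by have /forallP := blk x.
Qed.

Lemma triple_of_transversal sigma (c : U -> twist_group) :
    sigma \in projections n Omega -> (forall u, coset_rep (c u) = c u) ->
    (forall u v, sigma u = sigma v -> c u = c v -> u = v) ->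
    (forall i a, coset_rep a = a -> exists2 u, sigma u = i & c u = a) ->
  triple_of c \in transversal_triples Omega.
Proof.
move=> sP cE inj sur.
have tr a : coset_rep a = a -> [set x | c x == a] \in transversals Omega.
  move=> aE; apply/(transversalP _ sP); split=> [x y|i].
    by rewrite !inE => /eqP cx /eqP cy sxy; apply: inj; rewrite // cx cy.
  by have [x sx cx] := sur i a aE; exists x; rewrite // inE cx.
have dis a b : a <> b -> [disjoint [set x | c x == a] & [set x | c x == b]].
  move=> ab; rewrite disjoints_subset; apply/subsetP=> x.
  by rewrite !inE => /eqP ->; apply/eqP.
rewrite inE /= !tr // !dis //=; apply/eqP/setP=> x; rewrite !inE.
by have := cE x; case: (c x) => // _; rewrite eqxx ?orbT.
Qed.

Lemma exists_triple_sd_act tau sigma (x : sdgroup n) D :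
    sigma \in projections n Omega -> tau \in transversal_triples Omega ->
  exists tau' sigma',
    [/\ tau' \in transversal_triples Omega, sigma' \in projections n Omega
      & lift_bases Omega (sd_act x D) tau' sigma' =
        lift_bases Omega D tau sigma].
Proof.
move=> sP tP; pose sigma' := [ffun u => x.2 (sigma u)].
(* The labelling forced by [lift_bases_sd_act]: its condition is solved for the new label by
   inverting the right multiplication. *)
pose c u := coset_rep (label tau u * (x.1 (sigma' u))^-1)%g.
have sP' : sigma' \in projections n Omega := perm_projection x.2 sP.
have cE u : coset_rep (c u) = c u := coset_rep_id _.
have cV u a : coset_rep a = a ->
    c u = a <-> coset_rep (a * x.1 (sigma' u))%g = label tau u.
  by move=> aE; apply: coset_rep_mulV; rewrite ?label_rep.
have tP' : triple_of c \in transversal_triples Omega.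
  apply: (triple_of_transversal sP') => // [u v suv cuv | i a aE].
    apply: (label_inj sP tP); first by move: suv; rewrite !ffunE => /perm_inj.
    have cK w : coset_rep (c w * x.1 (sigma' w))%g = label tau w by apply/cV.
    by rewrite -!cK suv cuv.
  have [u su lu] := exists_label sP tP ((x.2^-1)%g i) (coset_rep_id (a * x.1 i)%g).
  have sui : sigma' u = i by rewrite ffunE su permKV.
  by exists u => //; apply/cV; rewrite // sui lu.
exists (triple_of c), sigma'; split=> //.
apply: lift_bases_sd_act => // u; first by rewrite ffunE.
by rewrite label_triple_of //; apply/cV.
Qed.

(** On each skew class the two labellings are bijections onto the three cosets, and some group
    element realises the permutation between them. *)
Lemma exists_sd_act tau tau' sigma sigma' :
    sigma \in projections n Omega -> sigma' \in projections n Omega ->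
    tau \in transversal_triples Omega -> tau' \in transversal_triples Omega ->
  exists x : sdgroup n, (forall u, sigma' u = x.2 (sigma u)) /\
    forall u, coset_rep (label tau' u * x.1 (sigma' u))%g = label tau u.
Proof.
move=> sP sP' tP tP'; have [p ss'] := projection_perm sP sP'.
have [g gP] : exists g : {ffun 'I_n -> twist_group}, forall i u,
    sigma' u = i -> coset_rep (label tau' u * g i)%g = label tau u.
  suff /fin_all_exists[g gP] i : exists g, forall u,
      sigma' u = i -> coset_rep (label tau' u * g)%g = label tau u.
    by exists (finfun g) => i u su; rewrite ffunE gP.
  (* The three points of the fibre over [i]; their labels under [tau] prescribe the permutation to
     be interpolated. *)
  have [u1 s1 l1] := @exists_label _ _ sP' tP' i G1 erefl.
  have [u2 s2 l2] := @exists_label _ _ sP' tP' i Gs erefl.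
  have [u3 s3 l3] := @exists_label _ _ sP' tP' i Gpsp erefl.
  have lne u v : sigma' u = i -> sigma' v = i -> label tau' u <> label tau' v ->
      label tau u <> label tau v.
    move=> su sv luv luv'; apply: luv; congr label.
    apply: (label_inj sP tP) luv'; apply: (@perm_inj _ p).
    by rewrite -!ss' su sv.
  have [g [g1 g2 g3]] : exists g, [/\ coset_rep (G1 * g)%g = label tau u1,
      coset_rep (Gs * g)%g = label tau u2
    & coset_rep (Gpsp * g)%g = label tau u3].
    by apply: coset_rep_interpolate; rewrite ?label_rep //; apply: lne;
      rewrite ?l1 ?l2 ?l3.
  exists g => u su; have := label_rep tau' u.
  case lu: (label tau' u) => // _.
  - by rewrite g1 (label_inj sP' tP' (etrans su (esym s1))) // lu.
  - by rewrite g2 (label_inj sP' tP' (etrans su (esym s2))) // lu.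
  - by rewrite g3 (label_inj sP' tP' (etrans su (esym s3))) // lu.
by exists (g, p); split=> // u; apply: gP.
Qed.

End Carrier.

Theorem theorem5p5 (n : nat) (D : setsystem n) (U : finType)
    (Omega : {set {set U}}) (tau : {set U} * {set U} * {set U})
    (sigma : {ffun U -> 'I_n})
    (D_vf : vf_safe D)
    (carrier : is_carrier3 n Omega)
    (tau_triple : tau \in transversal_triples Omega)
    (sigma_proj : sigma \in projections n Omega) :
  Orb D =
  [set D' : setsystem n | vf_safe D' &&
     [exists tau' in transversal_triples Omega,
      exists sigma' in projections n Omega,
        tight_lift Omega D' tau' sigma' == tight_lift Omega D tau sigma]].
Proof.
have /and3P[partO _ _] := carrier.
apply/setP=> D'; rewrite inE; apply/imsetP/andP=> [[x _ ->] | [_]].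
  split; first exact: sd_act_vf_safe.
  have [tau' [sigma' [tP sP E]]] :=
    exists_triple_sd_act partO x D sigma_proj tau_triple.
  apply/exists_inP; exists tau' => //; apply/exists_inP; exists sigma' => //.
  by rewrite /tight_lift E.
case/exists_inP=> tau' tP /exists_inP[sigma' sP /eqP[]].
move=> /(down_closure_bases_inj partO sP) E.
have [x [ss' ll']] := exists_sd_act partO sigma_proj sP tau_triple tP.
(* With [tau'] and [sigma'] fixed, [D'] and the image of [D] under [x] have the same lift bases, so
   they coincide. *)
exists x => //; apply: (lift_bases_inj partO sP tP).
by rewrite E (lift_bases_sd_act partO D sigma_proj sP tau_triple tP ss' ll').
Qed.
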